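(* Let $\mathcal{B}$ be a bornology with a closed base on a metric space $(X,d)$. If $(C(X),\tau_{\mathcal{B}}^s)$ is barreled, then the bornology $\mathcal{K}$ of all non-empty relatively compact subsets of $X$ is contained in $\mathcal{B}$.
   Context: $C(X)$ is the real vector space of all real-valued continuous functions on the metric space $(X,d)$. A bornology $\mathcal{B}$ on $(X,d)$ is a collection of nonempty subsets of $X$ that covers $X$ and is closed under finite unions and under taking (nonempty) subsets of its members. A base of $\mathcal{B}$ is a subfamily $\mathcal{B}_0\subseteq\mathcal{B}$ cofinal in $\mathcal{B}$ under inclusion; $\mathcal{B}$ has a closed base if it has a base all of whose members are closed in $(X,d)$. For $B\subseteq X$ and $\delta>0$, $B^\delta=\bigcup_{y\in B}\{x\in X:d(x,y)<\delta\}$. The topology $\tau_{\mathcal{B}}^s$ of strong uniform convergence on $\mathcal{B}$ is the topology on $C(X)$ determined by the uniformity with base consisting of the sets $[B,\epsilon]^s=\{(f,g):\exists\,\delta>0\ \forall x\in B^\delta,\ |f(x)-g(x)|<\epsilon\}$ ($B\in\mathcal{B}$, $\epsilon>0$). Equivalently, it is induced by the extended seminorms $\rho_B^s(f)=\inf_{\delta>0}\sup_{x\in B^\delta}|f(x)|\in[0,\infty]$, $B\in\mathcal{B}$ (i.e. the sets $\{g:\rho_B^s(g-f)<\epsilon\}$ form a subbase). The space $(C(X),\tau_{\mathcal{B}}^s)$ is barreled if every barrel in it (closed, convex, balanced, absorbing subset) is a neighborhood of $0$. A subset is relatively compact if its closure in $X$ is compact. *)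

(* Defs.v *)
From HB Require Import structures.
From mathcomp Require Import all_boot all_order all_algebra.
From mathcomp Require Import all_classical all_reals all_analysis.

Set Implicit Arguments.
Unset Strict Implicit.
Unset Printing Implicit Defensive.

Import Order.TTheory GRing.Theory Num.Theory.
Import numFieldNormedType.Exports.

Local Open Scope classical_set_scope.
Local Open Scope ring_scope.

Section bornology.
Context {R : realType} {X : metricType R}.
Implicit Types (cB : set_system X) (B : set X).

Definition bornology cB :=
  [/\ forall B, cB B -> B !=set0,
      \bigcup_(B in cB) B = [set: X],
      forall A B, cB A -> cB B -> cB (A `|` B) &
      forall A B, cB B -> A !=set0 -> A `<=` B -> cB A].

Definition bornology_base cB (cB0 : set_system X) :=
  cB0 `<=` cB /\ (forall B, cB B -> exists2 B0, cB0 B0 & B `<=` B0).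

Definition has_closed_base cB :=
  exists2 cB0, bornology_base cB cB0 & forall B, cB0 B -> closed B.

Definition enlargement B (delta : R) : set X := \bigcup_(y in B) ball y delta.

Definition relatively_compact_bornology : set_system X :=
  [set A | A !=set0 /\ compact (closure A)].

End bornology.

Section continuous_function_lmodule.
Context {R : realType} {X : topologicalType}.
Local Notation CX := (continuousType X R).
Implicit Types (f g : CX) (a : R).

Let cst0_continuous : continuous (fun _ : X => 0 : R).
Proof. by move=> x; exact: cvg_cst. Qed.

Let opp_continuous f : continuous (fun x => - f x).
Proof. by move=> x; apply: continuousN; exact: cts_fun. Qed.

Let add_continuous f g : continuous (fun x => f x + g x).
Proof. by move=> x; apply: (@continuousD _ _ _ f g); exact: cts_fun. Qed.

Let scale_continuous a f : continuous (fun x => a * f x).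
Proof. by move=> x; apply: continuousM; [exact: cvg_cst|exact: cts_fun]. Qed.

Definition cfun0 : CX := mkcts cst0_continuous.
Definition cfun_opp f : CX := mkcts (@opp_continuous f).
Definition cfun_add f g : CX := mkcts (@add_continuous f g).
Definition cfun_scale a f : CX := mkcts (@scale_continuous a f).

Let cfun_addA : associative cfun_add.
Proof. by move=> f g h; apply/continuousEP => x; exact: addrA. Qed.

Let cfun_addC : commutative cfun_add.
Proof. by move=> f g; apply/continuousEP => x; exact: addrC. Qed.

Let cfun_add0 : left_id cfun0 cfun_add.
Proof. by move=> f; apply/continuousEP => x; exact: add0r. Qed.

Let cfun_addN : left_inverse cfun0 cfun_opp cfun_add.
Proof. by move=> f; apply/continuousEP => x; exact: addNr. Qed.

HB.instance Definition _ := GRing.isZmodule.Build CX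
  cfun_addA cfun_addC cfun_add0 cfun_addN.

Let cfun_scaleA a b f : cfun_scale a (cfun_scale b f) = cfun_scale (a * b) f.
Proof. by apply/continuousEP => x; exact: mulrA. Qed.

Let cfun_scale1 : left_id 1 cfun_scale.
Proof. by move=> f; apply/continuousEP => x; exact: mul1r. Qed.

Let cfun_scaleDr : right_distributive cfun_scale +%R.
Proof. by move=> a f g; apply/continuousEP => x; exact: mulrDr. Qed.

Let cfun_scaleDl f : {morph cfun_scale^~ f : a b / a + b}.
Proof. by move=> a b; apply/continuousEP => x; exact: mulrDl. Qed.

HB.instance Definition _ := GRing.Zmodule_isLmodule.Build R CX
  cfun_scaleA cfun_scale1 cfun_scaleDr cfun_scaleDl.

End continuous_function_lmodule.

(* C(X) as a plain real vector space; the phantom argument cB makes the uniform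
   structure of strong uniform convergence on cB inferable from the type. *)
Definition strong_cfun {R : realType} {X : metricType R} (cB : set_system X) :
  Type := continuousType X R.

Section strong_uniform_convergence.
Context {R : realType} {X : metricType R} (cB : set_system X).
Local Notation CX := (continuousType X R).
Local Notation CB := (strong_cfun cB).

Definition strong_entourage (B : set X) (e : R) : set (CX * CX) :=
  [set fg : CX * CX | exists2 delta, 0 < delta &
    forall x, enlargement B delta x -> `|fg.1 x - fg.2 x| < e].

(* When X is inhabited and cB is a bornology, the sets strong_entourage B e form
   a base of this filter, see strong_uniformityP; generating a filter from them
   gives a uniformity with no condition on cB, and covers an empty X too. *)
Definition strong_uniformity : set_system (CX * CX) :=
  smallest (@Filter _)
    [set strong_entourage B e | B in cB & e in [set e : R | 0 < e]].

#[local] Instance strong_uniformity_filter : Filter strong_uniformity.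
Proof.
split.
- by move=> F [FF _]; exact: filterT.
- move=> P Q uP uQ F FF; have [? _] := FF.
  by apply: filterI; [exact: uP|exact: uQ].
- move=> P Q PQ uP F FF; have [? _] := FF.
  by apply: filterS PQ _; exact: uP.
Qed.

Lemma strong_uniformity_entourage B e : cB B -> 0 < e ->
  strong_uniformity (strong_entourage B e).
Proof. by move=> BB e0 F [_]; apply; exists B => //; exists e. Qed.

Local Open Scope relation_scope.

Let strong_uniformity_diagonal A : strong_uniformity A -> diagonal `<=` A.
Proof.
apply; split; first by split => [//|P Q dP dQ|P Q PQ dP];
  [rewrite subsetI; split|exact: subset_trans PQ].
move=> _ [B BB] [e e0 <-] [f g]; rewrite /diagonal /= => ->.
by exists 1 => // x _; rewrite subrr normr0.
Qed.

Let strong_uniformity_inv A : strong_uniformity A -> strong_uniformity A^-1.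
Proof.
move=> /(_ [set A | strong_uniformity A^-1]); apply; split.
  split => /=; first exact: filterT.
  - by move=> P Q; exact: (@filterI _ strong_uniformity).
  - by move=> P Q PQ; apply: (@filterS _ strong_uniformity) => -[f g] /PQ.
move=> _ [B BB] [e e0 <-] /=.
apply: (filterS _ (strong_uniformity_entourage BB e0)) => -[f g] [d d0 fg].
by exists d => // x /fg /=; rewrite distrC.
Qed.

Let strong_uniformity_split A : strong_uniformity A ->
  exists2 B, strong_uniformity B & B \; B `<=` A.
Proof.
move=> /(_ [set A | exists2 B, strong_uniformity B & B \; B `<=` A]).
apply; split.
  split => /=.
  - by exists setT => //; exact: filterT.
  - move=> P Q [P' uP P'P] [Q' uQ Q'Q]; exists (P' `&` Q').
      exact: (@filterI _ strong_uniformity).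
    by move=> [f h] [g [? ?] [? ?]]; split; [apply: P'P|apply: Q'Q]; exists g.
  - by move=> P Q PQ [P' uP P'P]; exists P' => //; exact: subset_trans PQ.
move=> _ [B BB] [e e0 <-] /=; exists (strong_entourage B (e / 2)).
  by apply: strong_uniformity_entourage => //; exact: divr_gt0.
move=> [f h] [g [d d0 fg] [d' d'0 gh]].
exists (Num.min d d'); first by rewrite lt_min d0.
move=> x [y By yx]; rewrite /= [e]splitr -(subrKA (g x)).
apply: le_lt_trans (ler_normD _ _) _; apply: ltrD.
  by apply: fg; exists y => //; apply: le_ball yx; rewrite ge_min lexx.
by apply: gh; exists y => //; apply: le_ball yx; rewrite ge_min lexx orbT.
Qed.

HB.instance Definition _ := GRing.Lmodule.copy CB CX.
HB.instance Definition _ := isUniform.Build CB strong_uniformity_filter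
  strong_uniformity_diagonal strong_uniformity_inv strong_uniformity_split.

Lemma strong_uniformityP (x0 : X) (A : set (CB * CB)) : bornology cB ->
  entourage A <->
  exists B e, [/\ cB B, 0 < e & strong_entourage B e `<=` A].
Proof.
move=> [_ cov BU _]; split; last first.
  move=> [B [e [BB e0 sA]]]; apply: (@filterS _ strong_uniformity _ _ _ sA).
  exact: strong_uniformity_entourage.
have [B0 BB0 _] : (\bigcup_(B in cB) B) x0 by rewrite cov.
move=> /(_ [set A | exists B e,
  [/\ cB B, 0 < e & strong_entourage B e `<=` A]]).
apply; split; last by move=> _ [B BB] [e e0 <-]; exists B, e; split.
split => /=.
- by exists B0, 1.
- move=> P Q [B [e [BB e0 sP]]] [B' [e' [BB' e'0 sQ]]].
  exists (B `|` B'), (Num.min e e'); split; [exact: BU|by rewrite lt_min e0|].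
  move=> fg [d d0 H]; split; [apply: sP|apply: sQ]; exists d => // x [y By yx];
    have /(_ x) := H; rewrite lt_min => /(_ _)/andP[]//; exists y => //;
    by [left|right].
- by move=> P Q PQ [B [e [BB e0 sP]]]; exists B, e; split => //;
    exact: subset_trans PQ.
Qed.

End strong_uniform_convergence.

Section barrels.
Context {R : realType} {E : preTopologicalLmodType R}.
Implicit Types A : set E.

Definition balanced A :=
  forall a : R, `|a| <= 1 -> [set a *: x | x in A] `<=` A.

Definition absorbing A :=
  forall x : E, exists2 r : R, 0 < r &
    forall a : R, r <= `|a| -> [set a *: y | y in A] x.

Definition barrel A := [/\ closed A, convex_set A, balanced A & absorbing A].

End barrels.

Definition barreled {R : realType} (E : preTopologicalLmodType R) :=
  forall A : set E, barrel A -> nbhs 0 A.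

(* Main.v *)
(* If K is compact, the unit ball of the seminorm sup_K |f| is a barrel.  Were
   it a neighborhood of 0, then any f vanishing on an enlargement of a suitable
   closed B in cB would satisfy |f| <= 1 on K; a bump function at a point of K
   outside B contradicts this, so K is contained in B. *)
Require Import Defs.
From mathcomp Require Import all_boot all_order all_algebra.
From mathcomp Require Import all_classical all_reals all_analysis.

Set Implicit Arguments.
Unset Strict Implicit.
Unset Printing Implicit Defensive.

Import Order.TTheory GRing.Theory Num.Theory.
Import numFieldNormedType.Exports.

Local Open Scope classical_set_scope.
Local Open Scope ring_scope.

Section unit_ball.
Context {R : realType} {X : metricType R} (cB : set_system X).
Local Notation CB := (strong_cfun cB).
Implicit Types (f : CB) (K : set X).

Definition eval f : X -> R := (f : continuousType X R).

Definition sup_unit_ball K : set CB :=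
  [set f | forall x, K x -> `|eval f x| <= 1].

(** The members of [cB] cover [X], so closeness in the strong uniformity controls the value at any
    given point, and the bound by 1 survives in the limit. *)
Lemma sup_unit_ball_closed K : bornology cB -> closed (sup_unit_ball K).
Proof.
move=> [_ cov _ _] f Kf x Kx; rewrite leNgt; apply/negP => fx1.
have [B BB Bx] : (\bigcup_(B in cB) B) x by rewrite cov.
(* The tolerance is the excess over 1: any [g] this close to [f] at [x] still has absolute value
   above 1 there. *)
have e0 : 0 < `|eval f x| - 1 by rewrite subr_gt0.
have [g [Kg]] := Kf _ (nbhs_entourage f (strong_uniformity_entourage BB e0)).
rewrite /xsection /= inE => -[d d0 /(_ x)] /=.
have dBx : enlargement B d x by exists x => //; exact: ballxx.
move=> /(_ dBx) /(le_lt_trans (lerB_normD _ _)).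
by apply/negP; rewrite -leNgt normrN lerB// Kg.
Qed.

Lemma sup_unit_ball_convex K : convex_set (sup_unit_ball K).
Proof.
move=> f g l; rewrite !inE => Kf Kg x Kx.
change (`|l%:num * eval f x + (1 - l%:num) * eval g x| <= 1).
have l0 : 0 <= l%:num by [].
have l1 : 0 <= 1 - l%:num by rewrite subr_ge0.
rewrite (le_trans (ler_normD _ _))// !normrM (ger0_norm l0) (ger0_norm l1).
by rewrite -[leRHS](subrKC l%:num) lerD// ler_piMr ?Kf ?Kg.
Qed.

Lemma sup_unit_ball_balanced K : balanced (sup_unit_ball K).
Proof.
move=> a a1 _ [f Kf <-] x Kx; change (`|a * eval f x| <= 1).
by rewrite normrM mulr_ile1// Kf.
Qed.

(** A continuous function is bounded on a compact set, and any such positive bound serves as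
    absorption radius. *)
Lemma sup_unit_ball_absorbing K : compact K -> absorbing (sup_unit_ball K).
Proof.
move=> cK f.
have ctsf : {within K, continuous (eval f)}.
  by apply: continuous_subspaceT => x; exact: cts_fun.
have /ex_strict_bound_gt0[M M0 fM] := compact_bounded (continuous_compact ctsf cK).
exists M => // a Ma; have a0 : 0 < `|a| by exact: lt_le_trans Ma.
exists (a^-1 *: f); last by rewrite scalerA mulfV ?scale1r// -normr_gt0.
move=> x Kx; change (`|a^-1 * eval f x| <= 1).
rewrite normrM normfV ler_pdivrMl// mulr1 (le_trans _ Ma)// ltW//.
by apply: fM; exists x.
Qed.

Lemma sup_unit_ball_barrel K : bornology cB -> compact K ->
  barrel (sup_unit_ball K).
Proof.
move=> bB cK; split.
- exact: sup_unit_ball_closed.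
- exact: sup_unit_ball_convex.
- exact: sup_unit_ball_balanced.
- exact: sup_unit_ball_absorbing.
Qed.

(** If the ball of radius [r] at [x] misses [B], halving [r] keeps the [r / 2]-enlargement of [B]
    away from the ball of radius [r / 2] at [x]; a Urysohn function separates [x] from the
    complement of the latter. *)
Lemma closed_bump (B : set X) (x : X) : closed B -> ~ B x ->
  exists f : CB, eval f x = 2 /\
    exists2 d, 0 < d & forall y, enlargement B d y -> eval f y = 0.
Proof.
move=> clB Bx.
have /nbhs_ballP[r /= r0 rB] : nbhs x (~` B).
  by apply: open_nbhs_nbhs; split => //; exact: closed_openC.
have r20 : 0 < r / 2 by rewrite divr_gt0.
have /(@uniform_separatorP _ R)[f [cf _ f0 f1]] :
    uniform_separator (~` ball x (r / 2)) [set x].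
  apply: uniform_separatorW; exists [set yz | ball yz.1 (r / 2) yz.2].
    exact: (entourage_ball X (PosNum r20)).
  by rewrite -subset0 => -[y z] [[/= xy ->]] /ball_sym.
(* Doubling makes the value at [x] exceed the bound 1 of the unit ball. *)
exists ((2 : R) *: (mkcts cf : CB)); split.
  have /= fx : f x = 1 by apply: f1; exists x.
  by change (2 * f x = 2); rewrite fx mulr1.
exists (r / 2) => // y [b Bb yb]; change (2 * f y = 0).
have /= -> : f y = 0; last by rewrite mulr0.
apply: f0; exists y => //= xy; apply: (rB b) => //=.
by rewrite [r]splitr; apply: ball_triangle xy _; exact: ball_sym.
Qed.

Lemma nbhs_sup_unit_ball K : bornology cB -> has_closed_base cB ->
  K !=set0 -> nbhs 0 (sup_unit_ball K) -> cB K.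
Proof.
move=> bB [cB0 [cB0B base] cl] K0 /nbhsP[E entE EK].
(* A point of [K] witnesses that [X] is inhabited, so a basic entourage can be extracted. *)
have [x0 _] := K0; have [B [e [BB e0 BE]]] := (strong_uniformityP x0 _ bB).1 entE.
(* Enlarging [B] to a closed [C] lets each point outside [C] be separated from it by a bump
   function. *)
have [C CC BC] := base _ BB.
have [_ _ _ sub] := bB; apply: (sub K C) => //; first exact: cB0B.
move=> x Kx; apply: contrapT => Cx.
have [f [fx [d d0 fd]]] := closed_bump (cl _ CC) Cx.
suff /(_ x Kx) : sup_unit_ball K f by rewrite fx leNgt ger0_norm// ltr1n.
(* Since [f] vanishes on an enlargement of [C], hence of [B], it is close to 0 for every [e]. *)
apply: EK; rewrite /xsection /= inE; apply: BE; exists d => // y [b Bb yb].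
have fy : eval f y = 0 by apply: fd; exists b => //; exact: BC.
by change (`|0 - eval f y| < e); rewrite fy subrr normr0.
Qed.

End unit_ball.

Theorem theorem4p3 (R : realType) (X : metricType R) (cB : set_system X) :
  bornology cB -> has_closed_base cB -> barreled (strong_cfun cB) ->
  relatively_compact_bornology `<=` cB.
Proof.
move=> bB clB bar K [[x Kx] cK].
(* The barrel is built on the compact set [closure K]; [K] then belongs to [cB] by heredity. *)
have [_ _ _ sub] := bB; apply: (sub K (closure K)).
- apply: nbhs_sup_unit_ball => //; first by exists x; exact: subset_closure.
  exact/bar/sup_unit_ball_barrel.
- by exists x.
- exact: subset_closure.
Qed.
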